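(* Let $\mathcal M$ be a sweep oriented matroid on $\binom{[n]}{2}$ with little oriented matroid $\mathcal L(\mathcal M)$. Then there is a weak map from the first Dilworth truncation $D(\underline{\mathcal L(\mathcal M)})$ to $\underline{\mathcal M}$; that is, $\mathrm{rk}_{\underline{\mathcal M}}(G)\le \mathrm{rk}_{D(\underline{\mathcal L(\mathcal M)})}(G)$ for every $G\subseteq\binom{[n]}{2}$.
   Context: For an oriented matroid $\mathcal N$ on $E$ (given by covectors), $\underline{\mathcal N}$ is its underlying matroid; the rank $\mathrm{rk}_{\mathcal N}(S)$ of $S\subseteq E$ is the rank (length of maximal chains of covectors, order $0\prec\pm$) of the restriction $\{X|_S\}$. For a matroid $\underline{\mathcal N}$ on $E$, the first Dilworth truncation $D(\underline{\mathcal N})$ is the matroid on the set $\binom{E}{2}$ of pairs of elements of $E$ with rank function $\mathrm{rk}(\emptyset)=0$ and, for nonempty $F$, $\mathrm{rk}(F)=\min\sum_{k=1}^{l}\big(\mathrm{rk}_{\underline{\mathcal N}}(\bigcup\{\{i,j\}:(i,j)\in F_k\})-1\big)$, the minimum over all unordered partitions $\{F_1,\dots,F_l\}$ of $F$ into nonempty parts. $\binom{[n]}{2}$ is the set of pairs $(i,j)$, $i<j$; for an ordered partition $I$ of $[n]$ with block-index map $p_I$, $X^I_{(i,j)}=+,-,0$ according as $p_I(i)<,>,=p_I(j)$; a sweep oriented matroid is an oriented matroid on $\binom{[n]}{2}$ all of whose covectors are of the form $X^I$. For a covector $X=X^{I_X}$ with $l_X$ blocks, $p_X=p_{I_X}$,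 and $1\le k\le2l_X+1$, $X^k$ on $[n]\cup\binom{[n]}{2}$ has $X^k_{(i,j)}=X_{(i,j)}$ and $X^k_i=-$ if $p_X(i)\le\lfloor\frac{k-1}{2}\rfloor$, $+$ if $p_X(i)>\lfloor\frac k2\rfloor$, $0$ if $k$ even and $p_X(i)=\frac k2$. The little oriented matroid $\mathcal L(\mathcal M)$ is the restriction to $[n]$ of the oriented matroid $\{X^k: X\in\mathcal M,1\le k\le 2l_X+1\}$. *)

(* Defs.v *)
From HB Require Import structures.
From mathcomp Require Import all_boot all_order all_algebra.

Set Implicit Arguments.
Unset Strict Implicit.
Unset Printing Implicit Defensive.

Inductive sign : Type := Neg | Zero | Pos.

Definition sign_code (s : sign) : option bool :=
  match s with Neg => Some false | Zero => None | Pos => Some true end.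
Definition sign_decode (c : option bool) : sign :=
  match c with Some false => Neg | None => Zero | Some true => Pos end.
Lemma sign_codeK : cancel sign_code sign_decode.
Proof. by case. Qed.

HB.instance Definition _ := Countable.copy sign (can_type sign_codeK).
HB.instance Definition _ : isFinite sign := CanIsFinite sign_codeK.

Definition sopp (s : sign) : sign :=
  match s with Neg => Pos | Zero => Zero | Pos => Neg end.

Notation signvec E := {ffun E -> sign}.

Section OrientedMatroids.

Variable E : finType.
Implicit Types (X Y Z : signvec E) (L : {set signvec E}) (S : {set E}).

Definition sv0 : signvec E := [ffun=> Zero].
Definition sv_opp X : signvec E := [ffun e => sopp (X e)].
Definition sv_comp X Y : signvec E :=
  [ffun e => if X e == Zero then Y e else X e].
Definition sv_sep X Y : {set E} :=
  [set e | (X e != Zero) && (Y e == sopp (X e))].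

Definition oriented_matroid L : Prop :=
  [/\ sv0 \in L,
      forall X, X \in L -> sv_opp X \in L,
      forall X Y, X \in L -> Y \in L -> sv_comp X Y \in L
    & forall X Y e, X \in L -> Y \in L -> e \in sv_sep X Y ->
        exists Z, [/\ Z \in L, Z e = Zero
          & forall f, f \notin sv_sep X Y -> Z f = sv_comp X Y f]].

(* The product of the order on signs in which Zero lies below Neg and Pos,
   which are incomparable. *)
Definition sv_le X Y : bool := [forall e, (X e == Zero) || (X e == Y e)].

Definition sv_chain (C : {set signvec E}) : bool :=
  [forall X in C, forall Y in C, sv_le X Y || sv_le Y X].

(* A chain with m elements has length m - 1. *)
Definition poset_rank L : nat :=
  \max_(C : {set signvec E} | (C \subset L) && sv_chain C) #|C|.-1.

End OrientedMatroids.

(* Only used with an injective f, the inclusion of a subset of E: this is then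
   the restriction of L to that subset. *)
Definition om_restrict (E E' : finType) (f : E' -> E) (L : {set signvec E}) :
    {set signvec E'} :=
  [set [ffun e => X (f e)] | X : signvec E in L].

Definition om_rank (E : finType) (L : {set signvec E}) (S : {set E}) : nat :=
  poset_rank (om_restrict (val : {e : E | e \in S} -> E) L).

Notation pairs n := {e : 'I_n * 'I_n | e.1 < e.2}.

Section Dilworth.

Variable n : nat.
Implicit Types (F : {set pairs n}) (P : {set {set pairs n}}).

Definition pair_support F : {set 'I_n} :=
  \bigcup_(e in F) [set (val e).1; (val e).2].

(* The subtraction takes place in int, where it is not truncated. *)
Definition dilworth_cost (r : {set 'I_n} -> nat) P : int :=
  (\sum_(F in P) ((r (pair_support F))%:Z - 1))%R.

(* When F is nonempty, [set F] is a partition of F, so that the arg min is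
   indeed a partition of F of minimal cost. *)
Definition dilworth_rank (r : {set 'I_n} -> nat) F : int :=
  if F == set0 then 0%R
  else dilworth_cost r
    [arg min_(P < [set F] | partition P F) dilworth_cost r P]%O.

End Dilworth.

Section Sweeps.

Variable n : nat.
Implicit Types (I : seq {set 'I_n}) (M : {set signvec (pairs n)}).

Definition ordered_partition I : bool :=
  uniq I && partition [set:: I] [set: 'I_n].

(* Blocks are numbered from 1. *)
Definition block_index I (i : 'I_n) : nat :=
  (find (fun B : {set 'I_n} => i \in B) I).+1.

Definition sweep_vec I : signvec (pairs n) :=
  [ffun e => let i := block_index I (val e).1 in
             let j := block_index I (val e).2 in
             if i < j then Pos else if j < i then Neg else Zero].

Definition sweep_oriented_matroid M : Prop :=
  oriented_matroid M /\
  (forall X, X \in M -> exists2 I, ordered_partition I & X = sweep_vec I).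

(* For k > 0, the last case of inl i is that k is even and the block index of i
   is k / 2. *)
Definition big_vec I (k : nat) : signvec ('I_n + pairs n)%type :=
  [ffun x => match x with
             | inl i => if block_index I i <= k.-1./2 then Neg
                        else if k./2 < block_index I i then Pos
                        else Zero
             | inr e => sweep_vec I e
             end].

(* An ordered partition of 'I_n has at most n blocks, so nothing is lost by
   letting I range over the finite type of sequences of size at most n; and I is
   determined by sweep_vec I. *)
Definition big_oriented_matroid M : {set signvec ('I_n + pairs n)%type} :=
  [set Z | [exists I : n.-bseq {set 'I_n}, exists k : 'I_(2 * size I).+2,
     [&& ordered_partition I, sweep_vec I \in M, 1 <= k
       & Z == big_vec I k]]].

Definition little_oriented_matroid M : {set signvec 'I_n} :=
  om_restrict inl (big_oriented_matroid M).

End Sweeps.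

(* Main.v *)
(** Pairs carry the matroid closure defined by the covectors of [M]: [e] is in
    the closure of [A] when every covector vanishing on [A] vanishes at [e].
    Covector elimination is the exchange property of this closure, so bases and
    a subadditive rank are available, and a chain of covectors restricted to [S]
    is at most as long as the rank of [S].  It remains to see that a nonempty set
    of pairs with support [S] has rank at most [rk_L(S) - 1].  It lies in the
    closure of the star of pairs joining a fixed [c] in [S] to the other elements
    of [S], since blocks are classes of an equivalence.  A basis of the star
    yields a chain of covectors of [M], by composition; sweeping each of them up
    to the block of [c] gives a chain of equal length in [L] restricted to [S],
    whose members vanish at [c], and sweeping the last one to just before that
    block adds one more step. *)
Require Import Defs.
From mathcomp Require Import all_boot all_order all_algebra.
From mathcomp Require Import zify.

Set Implicit Arguments.
Unset Strict Implicit.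
Unset Printing Implicit Defensive.

Import Order.TTheory GRing.Theory Num.Theory.

Lemma sopp_eq0 s : (sopp s == Zero) = (s == Zero).
Proof. by case: s. Qed.

(** * The order on sign vectors and lower bounds on the length of chains *)

Section SignVectors.

Variable E : finType.
Implicit Types (X Y Z : signvec E) (L : {set signvec E}).

Lemma sv_le_refl X : sv_le X X.
Proof. by apply/forallP => e; rewrite eqxx orbT. Qed.

Lemma sv_le_trans Y X Z : sv_le X Y -> sv_le Y Z -> sv_le X Z.
Proof.
move=> /forallP XY /forallP YZ; apply/forallP => e.
by have := XY e; case/orP => [->//|/eqP ->]; apply: YZ.
Qed.

Lemma sv_le_anti X Y : sv_le X Y -> sv_le Y X -> X = Y.
Proof.
move=> /forallP XY /forallP YX; apply/ffunP => e.
have := XY e; case/orP => /eqP // Xe.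
by have := YX e; rewrite Xe orbb => /eqP.
Qed.

Lemma sv_le_comp X Y : sv_le X (sv_comp X Y).
Proof. by apply/forallP => e; rewrite ffunE; case: ifP => //= _; rewrite eqxx. Qed.

Lemma sv_lt_witness X Y :
  sv_le X Y -> X != Y -> exists2 e, X e = Zero & Y e != Zero.
Proof.
move=> /forallP XY neXY.
have [e /andP[/eqP Xe Ye]|no] := pickP (fun e => (X e == Zero) && (Y e != Zero)).
  by exists e.
case/eqP: neXY; apply/ffunP => e; have := XY e.
case/orP => /eqP // Xe; have := no e.
by rewrite Xe /=; case: (Y e).
Qed.

(** Antisymmetry turns strictness of the consecutive steps into injectivity of [W] on the indices up
    to [m], giving a chain of [m.+1] elements. *)
Lemma poset_rank_geq L m (W : nat -> signvec E) :
    (forall j, j <= m -> W j \in L) ->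
    (forall j, j < m -> sv_le (W j) (W j.+1)) ->
    (forall j, j < m -> W j != W j.+1) ->
  m <= poset_rank L.
Proof.
move=> WL Wle Wne.
have Wmono i j : i <= j -> j <= m -> sv_le (W i) (W j).
  move=> ij; rewrite -(subnKC ij); elim: (j - i) => [|d IH] dm.
    by rewrite addn0 sv_le_refl.
  rewrite addnS in dm *; apply: sv_le_trans (IH (ltnW dm)) _.
  exact: Wle.
have Wlt i j : i < j -> j <= m -> W i != W j.
  move=> ij jm; apply: contra (Wne i (leq_trans ij jm)) => /eqP Wij.
  apply/eqP; apply: sv_le_anti; first exact/Wle/(leq_trans ij).
  by rewrite Wij; exact: Wmono.
have Winj : injective (fun j : 'I_m.+1 => W j).
  move=> i j /= Wij; apply: val_inj => /=.
  case: (ltngtP i j) => // lt.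
    by have := Wlt i j lt (ltn_ord j); rewrite Wij eqxx.
  by have := Wlt j i lt (ltn_ord i); rewrite Wij eqxx.
pose C := [set W j | j : 'I_m.+1].
have -> : m = #|C|.-1 by rewrite card_imset // card_ord.
apply: (leq_bigmax_cond (F := fun C : {set signvec E} => #|C|.-1)).
apply/andP; split.
  by apply/subsetP => _ /imsetP[j _ ->]; apply: WL; rewrite -ltnS.
apply/forall_inP => _ /imsetP[i _ ->].
apply/forall_inP => _ /imsetP[j _ ->].
by have /orP[ij|ji] := leq_total i j; apply/orP; [left|right];
  apply: Wmono => //; rewrite -ltnS.
Qed.

End SignVectors.

(** * The matroid of the closure defined by covectors *)

Section Closure.

Variables (E : finType) (L : {set signvec E}).
Hypothesis omL : oriented_matroid L.
Implicit Types (A B I T S : {set E}) (e f : E).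

(** The intersection of the zero sets of covectors that contain [A]: the flat spanned by [A] in the
    underlying matroid. *)
Definition sv_closure A : {set E} :=
  [set e | [forall X in L, [forall f in A, X f == Zero] ==> (X e == Zero)]].

Lemma sv_closureP A e :
  reflect (forall X, X \in L -> (forall f, f \in A -> X f = Zero) -> X e = Zero)
          (e \in sv_closure A).
Proof.
rewrite inE; apply: (iffP forall_inP) => H X XL.
  move=> XA; apply/eqP; apply: (implyP (H X XL)).
  by apply/forall_inP => f /XA ->.
by apply/implyP => /forall_inP XA; apply/eqP/H => // f /XA /eqP.
Qed.

Lemma notin_sv_closure A e : e \notin sv_closure A ->
  exists X, [/\ X \in L, forall f, f \in A -> X f = Zero & X e != Zero].
Proof.
rewrite inE; case/forall_inPn => X XL; rewrite negb_imply => /andP[/forall_inP XA Xe].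
by exists X; split=> // f /XA /eqP.
Qed.

Lemma sub_sv_closure A : A \subset sv_closure A.
Proof. by apply/subsetP => e eA; apply/sv_closureP => X _; apply. Qed.

Lemma sv_closure_min A B : A \subset sv_closure B -> sv_closure A \subset sv_closure B.
Proof.
move=> /subsetP AB; apply/subsetP => e /sv_closureP eA.
apply/sv_closureP => X XL XB; apply: eA => // f /AB /sv_closureP; exact.
Qed.

Lemma sv_closureS A B : A \subset B -> sv_closure A \subset sv_closure B.
Proof. by move=> AB; apply/sv_closure_min/(subset_trans AB)/sub_sv_closure. Qed.

(** Take [Y] zero on [A] and nonzero at [f], hence nonzero at [e]. If the conclusion fails, some [X]
    is zero on [f |: A] but not at [e]; eliminating [e] between them yields a covector zero on
    [e |: A] that still equals [Y] at [f], a contradiction. *)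
Lemma sv_closure_exchange A e f :
    f \in sv_closure (e |: A) -> f \notin sv_closure A ->
  e \in sv_closure (f |: A).
Proof.
case: omL => _ Lopp _ Lelim /sv_closureP feA /notin_sv_closure[Y [YL YA Yf]].
have Ye : Y e != Zero.
  apply: contra Yf => /eqP Ye; apply/eqP/feA => // g /setU1P[->//|]; exact: YA.
apply: contraT => /notin_sv_closure[X0 [X0L X0A X0e]].
(* Elimination needs opposite signs at [e], which [X0] or its opposite provides. *)
have [X [XL XA Xe]] : exists X,
    [/\ X \in L, forall g, g \in f |: A -> X g = Zero & Y e = sopp (X e)].
  have [Ye'|Ye'] := eqVneq (Y e) (sopp (X0 e)); first by exists X0.
  exists (sv_opp X0); split; [exact: Lopp| |].
    by move=> g /X0A X0g; rewrite ffunE X0g.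
  by rewrite ffunE; move: Ye Ye' X0e; case: (Y e); case: (X0 e).
have eXY : e \in sv_sep X Y.
  by rewrite inE Xe eqxx andbT; move: Ye; rewrite Xe sopp_eq0.
have [Z [ZL Ze ZXY]] := Lelim X Y e XL YL eXY.
have ZY g : g \in f |: A -> Z g = Y g.
  by move=> /XA Xg; rewrite ZXY ?inE ?ffunE Xg eqxx.
case/eqP: Yf; rewrite -ZY ?setU11 //; apply: feA => // g /setU1P[->//|gA].
by rewrite ZY ?setU1r // YA.
Qed.

Definition sv_indep I := [forall e in I, e \notin sv_closure (I :\ e)].

Lemma sv_indepP I :
  reflect (forall e, e \in I -> e \notin sv_closure (I :\ e)) (sv_indep I).
Proof. exact: forall_inP. Qed.

Lemma sv_indep0 : sv_indep set0.
Proof. by apply/sv_indepP => e; rewrite inE. Qed.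

Lemma sv_indepS I T : I \subset T -> sv_indep T -> sv_indep I.
Proof.
move=> IT /sv_indepP indT; apply/sv_indepP => e eI.
apply: contra (indT e (subsetP IT e eI)); apply/subsetP/sv_closureS.
exact: setSD.
Qed.

Lemma sv_indepU1 I e : sv_indep I -> e \notin sv_closure I -> sv_indep (e |: I).
Proof.
move=> /sv_indepP indI eI; have neI : e \notin I.
  by apply: contra eI; apply/subsetP/sub_sv_closure.
apply/sv_indepP => x /setU1P[->|xI]; first by rewrite setU1K.
have xe : e != x by apply: contraNneq neI => ->.
have -> : (e |: I) :\ x = e |: (I :\ x).
  by apply/setP => y; rewrite !inE; case: eqP => // ->; rewrite eq_sym (negPf xe).
apply: contra eI => xcl.
by have := sv_closure_exchange xcl (indI x xI); rewrite setD1K.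
Qed.

(** Steinitz exchange, by induction on the number of elements of [I] outside [T]. *)
Lemma sv_indep_card I T : sv_indep I -> I \subset sv_closure T -> #|I| <= #|T|.
Proof.
have [m] := ubnP #|I :\: T|; elim: m I => // m IH I.
rewrite ltnS => ITm indI IclT.
have [/eqP|[e]] := set_0Vmem (I :\: T).
  by rewrite setD_eq0; exact: subset_leq_card.
rewrite inE => /andP[eT eI].
(* If [T] lay in the closure of [I :\ e], so would [e]. Trading [e] for this [f] keeps size and
   independence and brings [I] closer to [T]. *)
have [f fT fcl] : exists2 f, f \in T & f \notin sv_closure (I :\ e).
  apply/subsetPn; apply: contra (sv_indepP _ indI e eI) => /sv_closure_min.
  by move=> /subsetP; apply; apply: (subsetP IclT).
have fI : f \notin I :\ e by apply: contra fcl; apply/subsetP/sub_sv_closure.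
have <- : #|f |: (I :\ e)| = #|I| by rewrite cardsU1 fI (cardsD1 e I) eI.
apply: IH; last 2 first.
- by apply: sv_indepU1 => //; apply: sv_indepS indI; exact: subsetDl.
- rewrite subUset sub1set (subsetP (sub_sv_closure T)) //=.
  by apply: subset_trans IclT; exact: subsetDl.
apply: leq_trans ITm; apply: proper_card; apply/properP; split.
  apply/subsetP => x; rewrite !inE; case/andP => xT.
  by case/orP => [/eqP xf|/andP[_ ->]]; [rewrite xf fT in xT | rewrite xT].
by exists e; rewrite !inE ?eT ?eI // eqxx orbF; apply: contraNneq eT => ->.
Qed.

(** A stand-in for [om_rank], defined by bases rather than chains so that subadditivity is within
    reach. *)
Definition sv_rank A := \max_(I : {set E} | (I \subset A) && sv_indep I) #|I|.

Lemma sv_rank_geq A I : I \subset A -> sv_indep I -> #|I| <= sv_rank A.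
Proof. by move=> IA indI; apply: leq_bigmax_cond; rewrite IA. Qed.

(** An independent subset of largest size spans, since an element outside its closure could be
    added. *)
Lemma sv_basis A :
  exists I, [/\ I \subset A, sv_indep I, #|I| = sv_rank A & A \subset sv_closure I].
Proof.
have [|I /andP[IA indI] rk] := @eq_bigmax_cond _
    [pred I : {set E} | (I \subset A) && sv_indep I] (fun I : {set E} => #|I|).
  by apply/card_gt0P; exists set0; rewrite inE sub0set sv_indep0.
exists I; split=> //; apply/subsetP => e eA; apply: contraT => ecl.
have := @sv_rank_geq A (e |: I); rewrite subUset sub1set eA IA => /(_ isT).
move=> /(_ (sv_indepU1 indI ecl)); rewrite /sv_rank rk cardsU1.
have -> : e \notin I by apply: contra ecl; apply/subsetP/sub_sv_closure.
by rewrite ltnn.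
Qed.

Lemma sv_rank_closure A B : A \subset sv_closure B -> sv_rank A <= sv_rank B.
Proof.
move=> AB; have [I [IA indI <- _]] := sv_basis A.
have [J [_ _ <- BJ]] := sv_basis B.
apply: sv_indep_card => //; apply: subset_trans IA (subset_trans AB _).
exact: sv_closure_min.
Qed.

Lemma sv_rankU A B : sv_rank (A :|: B) <= sv_rank A + sv_rank B.
Proof.
have [I [_ _ <- AI]] := sv_basis A; have [J [_ _ <- BJ]] := sv_basis B.
have [K [KAB indK <- _]] := sv_basis (A :|: B).
apply: leq_trans (leq_card_setU I J); apply: sv_indep_card => //.
apply: subset_trans KAB _; rewrite subUset.
rewrite (subset_trans AI) ?sv_closureS ?subsetUl //.
by rewrite (subset_trans BJ) ?sv_closureS ?subsetUr.
Qed.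

Lemma sv_rank_cover (P : {set {set E}}) :
  sv_rank (cover P) <= \sum_(A in P) sv_rank A.
Proof.
rewrite /cover; elim/big_rec2: _ => [|A m B _ IH].
  by rewrite /sv_rank; apply/bigmax_leqP => I /andP[]; rewrite subset0 => /eqP->; rewrite cards0.
by apply: leq_trans (sv_rankU _ _) _; rewrite leq_add2l.
Qed.

(* The rank of the zero set is strictly decreasing along a chain. *)
Lemma om_rank_leq S : om_rank L S <= sv_rank S.
Proof.
apply/bigmax_leqP => C /andP[/subsetP CL /forall_inP Cchain].
pose zset (X : signvec {e : E | e \in S}) := val @: [set e | X e == Zero].
pose rho (X : signvec {e : E | e \in S}) := sv_rank (zset X).
have rho_le X : rho X < (sv_rank S).+1.
  rewrite ltnS; apply: sv_rank_closure.
  apply: subset_trans (sub_sv_closure S); apply/subsetP => _ /imsetP[e _ ->].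
  exact: valP.
(* A basis of the zero set of [Y] is enlarged by a point where [X] vanishes and [Y] does not: the
   covector restricting to [Y] shows that this point is outside the closure of the basis. *)
have rho_lt X Y : Y \in C -> sv_le X Y -> X != Y -> rho Y < rho X.
  move=> /CL/imsetP[Y0 Y0L YE] XY neXY; have [e Xe Ye] := sv_lt_witness XY neXY.
  have [I [IY indI rkI _]] := sv_basis (zset Y); rewrite /rho -rkI.
  have ecl : val e \notin sv_closure I.
    apply: contra Ye => /sv_closureP ecl; apply/eqP.
    rewrite YE ffunE; apply: ecl => // f /(subsetP IY)/imsetP[g].
    by rewrite inE YE ffunE => /eqP ? ->.
  have eI : val e \notin I by apply: contra ecl; apply/subsetP/sub_sv_closure.
  have <- : #|val e |: I| = #|I|.+1 by rewrite cardsU1 eI.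
  apply: sv_rank_geq; last exact: sv_indepU1.
  rewrite subUset sub1set imset_f ?inE ?Xe //=.
  apply: subset_trans IY _; apply: imsetS; apply/subsetP => f.
  rewrite !inE => /eqP Yf; have /forallP/(_ f) := XY.
  by rewrite Yf orbb.
have rho_inj : {in C &, injective (fun X => Ordinal (rho_le X))}.
  move=> X Y XC YC [] rhoXY; apply/eqP; apply: contraT => neXY.
  have /forall_inP/(_ Y YC)/orP[XY|YX] := Cchain X XC.
    by have := rho_lt X Y YC XY neXY; rewrite rhoXY ltnn.
  by have := rho_lt Y X XC YX; rewrite eq_sym rhoXY ltnn => /(_ neXY).
(* [rho] embeds [C] into [sv_rank S + 1] values, and the length of a chain is one less than its
   size. *)
have := max_card [in [set Ordinal (rho_le X) | X in C]].
rewrite card_ord card_in_imset //; case: #|C| => [//|k]; exact.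
Qed.

(** Each [e] in [I] has a covector [x e] that vanishes on the rest of [I] but not at [e]; composing
    these one at a time makes one more element of [I] nonzero at each step. *)
Lemma sv_indep_chain I : sv_indep I ->
  exists W : nat -> signvec E, forall j, [/\ W j \in L, sv_le (W j) (W j.+1)
    & j < #|I| -> exists e, [/\ e \in I, W j e = Zero & W j.+1 e != Zero]].
Proof.
case: omL => L0 _ Lcomp _ /sv_indepP indI.
have [x xP] : exists x : E -> signvec E, forall e, x e \in L /\
    (e \in I -> (forall f, f \in I :\ e -> x e f = Zero) /\ x e e != Zero).
  apply: (fin_all_exists (P := fun e X => X \in L /\
    (e \in I -> (forall f, f \in I :\ e -> X f = Zero) /\ X e != Zero))) => e.
  have [eI|eI] := boolP (e \in I); last by exists (sv0 E).
  by have [X [XL XI Xe]] := notin_sv_closure (indI e eI); exists X.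
pose s := enum I.
(* Beyond the end of the enumeration [W] stays constant, so it is a weakly increasing sequence over
   all of [nat]. *)
pose W := fix W j := if j is k.+1 then
  (if onth s k is Some e then sv_comp (W k) (x e) else W k) else sv0 E.
have WL j : W j \in L.
  by elim: j => //= j IH; case: (onth s j) => // e; apply: Lcomp => //; case: (xP e).
(* The covectors composed before position [i] belong to other elements of [I], so they vanish at
   [e]. *)
have W0 j i e : onth s i = Some e -> j <= i -> W j e = Zero.
  move=> si; elim: j => [|j IH] ji /=; first by rewrite ffunE.
  case sj: (onth s j) => [f|]; last exact/IH/ltnW.
  rewrite ffunE (IH (ltnW ji)) eqxx.
  have lt k g : onth s k = Some g -> [/\ k < size s & nth g s k = g].
    move=> sk; case: (ltnP k (size s)) => ks; last by rewrite onth_default in sk.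
    by split=> //; exact: onth_nth.
  have [[is_ ei] [js fj]] := (lt _ _ si, lt _ _ sj).
  have eI : e \in I by rewrite -mem_enum -ei mem_nth.
  have fI : f \in I by rewrite -mem_enum -fj mem_nth.
  have [_ /(_ fI)[xf _]] := xP f; apply: xf; rewrite !inE eI andbT.
  rewrite -ei -fj (set_nth_default f e) // nth_uniq ?enum_uniq //.
  by rewrite neq_ltn ji orbT.
exists W => j; split=> [//|/=|].
  by case: (onth s j) => [e|]; [exact: sv_le_comp | exact: sv_le_refl].
rewrite cardE => js; case sj: (onth s j) => [e|]; last first.
  by have := onthTE s j; rewrite sj js.
have eI : e \in I by rewrite -mem_enum -/s; apply/onthP; exists j; rewrite sj.
exists e; split=> //; first exact: W0 sj _.
by rewrite /= sj ffunE (W0 _ _ _ sj) //=; case: (xP e) => _ /(_ eI)[].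
Qed.

End Closure.

(** * Sweep covectors, the star of an element, and the little oriented matroid *)

Section Sweeps.

Variable n : nat.
Implicit Types (J : seq {set 'I_n}) (X : signvec (pairs n)) (M : {set signvec (pairs n)})
  (c i : 'I_n).

(** The antisymmetric extension of [X] to all ordered pairs. Being read from [X] and not from an
    ordered partition, it inherits the order on covectors. *)
Definition sign_from X c i : sign :=
  if insub (c, i) is Some e then X e
  else if insub (i, c) is Some e then sopp (X e) else Zero.

Lemma sign_from_sweep J c i : sign_from (sweep_vec J) c i =
  if block_index J c < block_index J i then Pos
  else if block_index J i < block_index J c then Neg else Zero.
Proof.
rewrite /sign_from; case: insubP => [e _ eci|nci]; first by rewrite ffunE eci.
case: insubP => [e _ eic|nic]; first by rewrite ffunE eic /=; case: ltngtP.
suff -> : c = i by rewrite ltnn.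
by apply: val_inj; move: nci nic => /=; case: ltngtP.
Qed.

Lemma sign_from_le X Y c i : sv_le X Y ->
  (sign_from X c i == Zero) || (sign_from X c i == sign_from Y c i).
Proof.
move=> /forallP XY; rewrite /sign_from; case: insubP => // _.
case: insubP => // e _ _; rewrite sopp_eq0.
by have /orP[->//|/eqP ->] := XY e; rewrite eqxx orbT.
Qed.

Lemma block_index_gt0 J i : 0 < block_index J i.
Proof. by []. Qed.

Lemma block_index_leq J i : ordered_partition J -> block_index J i <= size J.
Proof.
case/andP => _ /and3P[/eqP covJ _ _]; rewrite /block_index -has_find.
have : i \in cover [set:: J] by rewrite covJ inE.
case/bigcupP => B; rewrite inE => BJ iB.
by apply/hasP; exists B.
Qed.

(** Blocks are nonempty and disjoint; the bound lets [J] be viewed as an element of the type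
    [n.-bseq] over which [big_oriented_matroid] ranges. *)
Lemma ordered_partition_size J : ordered_partition J -> size J <= n.
Proof.
case/andP => /card_uniqP <- partJ.
have := card_partition partJ; rewrite cardsT card_ord => cardn.
rewrite [leqRHS]cardn [leqRHS](eq_bigl (mem J)); last by move=> B; rewrite inE.
rewrite -sum1_card.
apply: leq_sum => B BJ; rewrite card_gt0.
by apply: contraTneq partJ => B0; rewrite /partition inE -B0 BJ !andbF.
Qed.

Lemma big_vec_little M J k : ordered_partition J -> sweep_vec J \in M ->
    0 < k <= (2 * size J).+1 ->
  [ffun i => big_vec J k (inl i)] \in little_oriented_matroid M.
Proof.
move=> partJ JM /andP[k0 kJ]; apply/imsetP; exists (big_vec J k) => //.
rewrite inE; apply/existsP; exists (Bseq (ordered_partition_size partJ)).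
apply/existsP; exists (Ordinal (kJ : k < (2 * size J).+2)).
by rewrite partJ JM k0 eqxx.
Qed.

Section Star.

Variables (M : {set signvec (pairs n)}) (sweepM : sweep_oriented_matroid M).
Variables (S : {set 'I_n}) (c : 'I_n) (cS : c \in S).

(* Sweeping [X] up to the block of [c], respectively to just before it. *)
Definition sweep_at X : signvec 'I_n := [ffun i => sign_from X c i].
Definition sweep_before X : signvec 'I_n :=
  [ffun i => if sign_from X c i == Neg then Neg else Pos].

Lemma sweep_at_little X : X \in M -> sweep_at X \in little_oriented_matroid M.
Proof.
case: sweepM => _ Msweep XM; have [J partJ XJ] := Msweep X XM.
(* The even index [2 * b] makes exactly the block numbered [b] zero. *)
have -> : sweep_at X = [ffun i => big_vec J (2 * block_index J c) (inl i)]; last first.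
  apply: big_vec_little; rewrite -?XJ //.
  by have := block_index_leq c partJ; have := block_index_gt0 J c; lia.
apply/ffunP => i.
rewrite !ffunE XJ sign_from_sweep.
set b := block_index J c; set a := block_index J i.
have b0 : 0 < b by [].
have -> : (a <= (2 * b).-1./2) = (a < b) by lia.
have -> : ((2 * b)./2 < a) = (b < a) by lia.
by case: ltngtP.
Qed.

Lemma sweep_before_little X : X \in M -> sweep_before X \in little_oriented_matroid M.
Proof.
case: sweepM => _ Msweep XM; have [J partJ XJ] := Msweep X XM.
(* At the odd index [2 * b - 1] both halves equal [b - 1], so no element is zero and the block of
   [c] is still [Pos]. *)
have -> : sweep_before X =
    [ffun i => big_vec J (2 * block_index J c).-1 (inl i)]; last first.
  apply: big_vec_little; rewrite -?XJ //.
  by have := block_index_leq c partJ; have := block_index_gt0 J c; lia.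
apply/ffunP => i.
rewrite !ffunE XJ sign_from_sweep.
set b := block_index J c; set a := block_index J i.
have b0 : 0 < b by [].
have -> : (a <= (2 * b).-1.-1./2) = (a < b) by lia.
have -> : ((2 * b).-1./2 < a) = (b <= a) by lia.
by case: ltngtP.
Qed.

Definition star : {set pairs n} :=
  [set e | [&& (val e).1 \in S, (val e).2 \in S
             & ((val e).1 == c) || ((val e).2 == c)]].

(** A covector vanishing on the star puts all of [S] into the block of [c], hence vanishes on every
    pair inside [S]. *)
Lemma star_closure (F : {set pairs n}) :
  pair_support F \subset S -> F \subset sv_closure M star.
Proof.
case: sweepM => _ Msweep /subsetP FS; apply/subsetP => e eF.
apply/sv_closureP => X /Msweep[J _ ->] Xstar.
have idx i : i \in S -> block_index J i = block_index J c.
  move=> iS; have : sign_from (sweep_vec J) c i = Zero.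
    rewrite /sign_from; case: insubP => [f _ fci|_].
      by apply: Xstar; rewrite inE fci /= cS iS eqxx.
    case: insubP => // f _ fic.
    by rewrite Xstar // inE fic /= cS iS eqxx orbT.
  by rewrite sign_from_sweep; case: ltngtP.
have ends i : i \in [set (val e).1; (val e).2] -> i \in S.
  by move=> ie; apply: FS; apply/bigcupP; exists e.
rewrite ffunE /= (idx (val e).1) ?(idx (val e).2) ?ltnn //;
  by apply: ends; rewrite !inE eqxx ?orbT.
Qed.

Lemma star_rank : sv_rank M star < om_rank (little_oriented_matroid M) S.
Proof.
case: (sweepM) => omM _.
have [I [Istar indI <- _]] := sv_basis omM star.
have [W WP] := sv_indep_chain omM indI.
pose res (Y : signvec 'I_n) : signvec {i | i \in S} := [ffun i => Y (val i)].
(* Indices [0] to [#|I|] carry the chain of [M]; index [#|I|.+1] is the extra step that makes the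
   inequality strict. *)
pose V j := res (if j <= #|I| then sweep_at (W j) else sweep_before (W #|I|)).
apply: (poset_rank_geq (W := V)) => j; rewrite /V.
- move=> _; apply/imsetP.
  exists (if j <= #|I| then sweep_at (W j) else sweep_before (W #|I|)) => //.
  have WM k : W k \in M by case: (WP k).
  by case: ifP => _; [exact: sweep_at_little | exact: sweep_before_little].
- rewrite ltnS => jI; rewrite jI; apply/forallP => i; rewrite !ffunE.
  have [jI'|Ij] := ltnP j #|I|; rewrite ffunE.
    by case: (WP j) => _ le _; exact: sign_from_le.
  have -> : j = #|I| by apply/eqP; rewrite eqn_leq jI Ij.
  by case: (sign_from _ _ _).
rewrite ltnS => jI; rewrite jI.
have [jI'|Ij] := ltnP j #|I|; last first.
  (* The extra step is strict at [c], where the sign goes from [Zero] to [Pos]. *)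
  apply/eqP => /ffunP/(_ (Sub c cS)); rewrite !ffunE SubK.
  by rewrite /sign_from !insubF //= ltnn.
case: (WP j) => _ _ /(_ jI')[e [eI Wje Wj1e]].
have := subsetP Istar e eI; rewrite inE => /and3P[e1S e2S ec].
(* The end of [e] other than [c] detects whether a covector vanishes at [e]. *)
have [i iS Wi] : exists2 i, i \in S
    & forall X, (sign_from X c i == Zero) = (X e == Zero).
  have [e1c|e1c] := eqVneq (val e).1 c.
    exists (val e).2 => // X; rewrite /sign_from -e1c -surjective_pairing.
    by rewrite valK.
  have e2c : (val e).2 = c by move: ec; rewrite (negPf e1c) => /eqP.
  exists (val e).1 => // X; rewrite /sign_from -e2c insubF.
    by rewrite -surjective_pairing valK sopp_eq0.
  by have := valP e => /=; case: ltngtP.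
apply: contra Wj1e => /eqP/ffunP/(_ (Sub i iS)); rewrite !ffunE SubK.
by rewrite -Wi => <-; rewrite Wi Wje.
Qed.

End Star.

(** Nonemptiness of [F] supplies the centre [c] of a star. The strict inequality accounts for the
    [- 1] of each part in [dilworth_cost]. *)
Lemma sv_rank_lt_little M (F : {set pairs n}) :
    sweep_oriented_matroid M -> F != set0 ->
  sv_rank M F < om_rank (little_oriented_matroid M) (pair_support F).
Proof.
move=> sweepM /set0Pn[e eF].
have cF : (val e).1 \in pair_support F.
  by apply/bigcupP; exists e; rewrite // !inE eqxx.
apply: leq_ltn_trans (star_rank sweepM cF).
by apply: sv_rank_closure; [case: sweepM | exact: star_closure].
Qed.

Lemma partition_set1 (F : {set pairs n}) : F != set0 -> partition [set F] F.
Proof.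
move=> F0; rewrite /partition /cover big_set1 eqxx inE eq_sym F0 andbT /=.
exact: trivIset1.
Qed.

End Sweeps.

Theorem theorem5p2 (n : nat) (M : {set signvec (pairs n)})
    (hM : sweep_oriented_matroid M) (G : {set pairs n}) :
  ((om_rank M G)%:Z <= dilworth_rank (om_rank (little_oriented_matroid M)) G)%R.
Proof.
have omM : oriented_matroid M by case: hM.
have rkG := om_rank_leq omM G.
rewrite /dilworth_rank; case: eqVneq => [G0|G0].
  move: rkG; rewrite G0 /sv_rank lez_nat => /leq_trans; apply.
  by apply/bigmax_leqP => I /andP[]; rewrite subset0 => /eqP ->; rewrite cards0.
case: arg_minP => [|P partP _]; first exact: partition_set1.
case/and3P: (partP) => /eqP covP _ P0.
(* Subadditivity over the parts comes first, then a comparison part by part in [int]. *)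
apply: (@le_trans _ _ (\sum_(F in P) sv_rank M F)%N%:Z%R).
  by rewrite lez_nat (leq_trans rkG) // -covP sv_rank_cover.
rewrite -natz natr_sum /dilworth_cost; apply: ler_sum => F FP.
have F0 : F != set0 by apply: contraNneq P0 => <-.
by have := sv_rank_lt_little hM F0; lia.
Qed.
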